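(* Let $\Gamma$ be an Abelian group with $n$ elements, let $S\subseteq\Gamma$ be a covering difference set of $\Gamma$ with $|S|=s$, and let $m\ge 1$ be an integer. Then the bipartite graph $G_m(S)=(V_0\cup V_1,E)$ has $(m+1)n$ vertices, where every vertex in $V_0$ has degree $ms$ and every vertex in $V_1$ has degree $s$. Moreover, the diameter of $G_m(S)$ is $3$.
   Context: Let $\Gamma$ be a finite group (written multiplicatively) and $S\subseteq\Gamma$. $S$ is a covering difference set (covering set) of $\Gamma$ if the multiset of differences $\{t\cdot t'^{-1} : t,t'\in S\}$ contains all the elements of $\Gamma$ (perhaps with some repetitions). For an integer $m\ge1$, $G_m(S)=(V_0\cup V_1,E)$ is the bipartite graph with independent sets $V_0=\{(0,u):u\in\Gamma\}$ and $V_1=\{(l,v): v\in\Gamma,\ 1\le l\le m\}$, and adjacencies $(l,v)\sim(0,v\cdot\sigma)$ for all $\sigma\in S$, $v\in\Gamma$ and $l\in\{1,\dots,m\}$.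
   Formalization: The diameter is claimed to be exactly 3 only for S ≠ Γ: when S = Γ the graph is the complete bipartite graph K_{n,mn}, of diameter 2 (or 1 if n = m = 1). In general the diameter is shown to exist and be at most 3. *)

(* Defs.v *)
From mathcomp Require Import all_boot all_fingroup.

Set Implicit Arguments.
Unset Strict Implicit.
Unset Printing Implicit Defensive.

Local Open Scope group_scope.

(* A simple graph on a finite vertex type T is an adjacency relation e : rel T
   that is symmetric and irreflexive. *)
Section Graph.
Variables (T : finType) (e : rel T).

Definition simple_graph : Prop := symmetric e /\ irreflexive e.

Definition independent (A : {set T}) : Prop :=
  {in A &, forall x y, ~~ e x y}.

Definition degree (x : T) : nat := #|[set y | e x y]|.

Definition walk (x y : T) (k : nat) : Prop :=
  exists p : seq T, [/\ path e x p, last x p = y & size p = k].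

(* Distance and diameter are relations, so that "infinite" is expressed by the
   absence of a value: no junk value is chosen for a disconnected graph. *)
Definition is_distance (x y : T) (d : nat) : Prop :=
  walk x y d /\ (forall k : nat, walk x y k -> (d <= k)%N).

Definition is_diameter (d : nat) : Prop :=
  (forall x y : T, exists2 k : nat, is_distance x y k & (k <= d)%N) /\
  (exists x y : T, is_distance x y d).

End Graph.

Section CoveringGraph.
Variable gT : finGroupType.

Definition covering_set (S : {set gT}) : Prop :=
  forall g : gT, exists t t' : gT, [/\ t \in S, t' \in S & g = t * t'^-1].

(* The vertex (l, u), 0 <= l <= m; label 0 gives V_0, labels 1..m give V_1. *)
Definition vertex (m : nat) : finType := ('I_m.+1 * gT)%type.

Definition V0 (m : nat) : {set vertex m} := [set x : vertex m | x.1 == ord0].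
Definition V1 (m : nat) : {set vertex m} := [set x : vertex m | x.1 != ord0].

Definition joined (m : nat) (S : {set gT}) (x y : vertex m) : bool :=
  [&& x \in V1 m, y \in V0 m & [exists sigma in S, y.2 == x.2 * sigma]].

Definition Gadj (m : nat) (S : {set gT}) : rel (vertex m) :=
  fun x y => joined S x y || joined S y x.

Lemma Gadj_simple (m : nat) (S : {set gT}) : simple_graph (@Gadj m S).
Proof.
split=> [x y|x]; first by rewrite /Gadj orbC.
by rewrite /Gadj /joined !inE orbb; case: (x.1 == ord0).
Qed.

Lemma Gadj_bipartite (m : nat) (S : {set gT}) :
  [/\ V0 m :|: V1 m = [set: vertex m], [disjoint V0 m & V1 m],
      independent (@Gadj m S) (V0 m) & independent (@Gadj m S) (V1 m)].
Proof.
split.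
- by apply/setP=> x; rewrite !inE orbN.
- by rewrite -setI_eq0; apply/eqP/setP=> x; rewrite !inE andbN.
- by move=> x y; rewrite !inE /Gadj /joined !inE => -> ->.
by move=> x y; rewrite !inE /Gadj /joined !inE => /negPf-> /negPf->; rewrite !andbF.
Qed.

End CoveringGraph.

Arguments V0 : clear implicits.
Arguments V1 : clear implicits.
Arguments Gadj {gT} m S _ _.

(* Main.v *)
Require Import Defs.
From mathcomp Require Import all_boot all_fingroup.

Set Implicit Arguments.
Unset Strict Implicit.
Unset Printing Implicit Defensive.

(** Two vertices on the same side always have a common neighbour: for V_1 this
    is the covering property of S applied to v^-1 v', and for V_0 it is the
    same property after commuting t t'^-1 = t'^-1 t, the only use of
    commutativity. Vertices on opposite sides are then joined by a walk of
    length 3. If g is not in S, then (0, g) and (l, 1) are not adjacent, and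
    bipartiteness excludes a walk of length 2, so their distance is 3. *)

Section Walks.
Variables (T : finType) (e : rel T).

(** Tuples of a fixed length over a finite type form a finite type, so this version of [walk] is
    decidable; the least-number principle [ex_minnP] needs that. *)
Definition walkb (x y : T) (k : nat) : bool :=
  [exists p : k.-tuple T, path e x p && (last x p == y)].

Lemma walkP x y k : reflect (walk e x y k) (walkb x y k).
Proof.
apply: (iffP existsP) => [[p /andP[ep /eqP lp]]|[p [ep lp sp]]].
  by exists p; rewrite size_tuple.
by exists (Tuple (introT eqP sp)); rewrite /= ep lp eqxx.
Qed.

Lemma walk0 x y : walk e x y 0 -> x = y.
Proof. by case=> [[|z p] []]. Qed.

Lemma walk1 x y : walk e x y 1 -> e x y.
Proof. by case=> [[|z [|? ?]] []] //= /andP[exz _] <-. Qed.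

Lemma walk2P x y : walk e x y 2 <-> exists2 z, e x z & e z y.
Proof.
split=> [[[|z [|w [|? ?]]] []] //= /and3P[exz ezw _] <- _|[z exz ezy]].
  by exists z.
by exists [:: z; y]; rewrite /= exz ezy.
Qed.

Lemma walk_cons x z y k : e x z -> walk e z y k -> walk e x y k.+1.
Proof. by move=> exz [p [ep lp sp]]; exists (z :: p); rewrite /= exz ep lp sp. Qed.

Lemma walk_rcons x z y k : walk e x z k -> e z y -> walk e x y k.+1.
Proof.
move=> [p [ep lp sp]] ezy; exists (rcons p y).
by rewrite rcons_path ep lp last_rcons size_rcons sp ezy.
Qed.

Lemma walk_distance x y k :
  walk e x y k -> exists2 d, is_distance e x y d & d <= k.
Proof.
move=> /walkP wk; case: (ex_minnP (ex_intro _ k wk)) => d /walkP wd dmin.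
by exists d; [split=> // j /walkP; apply: dmin | apply: dmin].
Qed.

(** The diameter is the least d such that every two vertices are joined by a walk of length at most
    d: by minimality, some pair fails the bound d - 1 and so lies at distance exactly d. *)
Lemma diameter_le (x0 : T) d0 :
    (forall x y, exists2 k, walk e x y k & k <= d0) ->
  exists2 d, is_diameter e d & d <= d0.
Proof.
move=> wle; pose P d := [forall x, forall y, exists k : 'I_d.+1, walkb x y k].
have Pd0 : P d0.
  apply/'forall_forallP => x y; have [k /walkP wk lek] := wle x y.
  by apply/existsP; exists (Ordinal (lek : k < d0.+1)).
case: (ex_minnP (ex_intro P d0 Pd0)) => d /'forall_forallP Pd dmin.
exists d; last exact: dmin.
split=> [x y|].
  have /existsP[k /walkP /walk_distance[j dj lej]] := Pd x y.
  by exists j => //; apply: leq_trans lej _; rewrite -ltnS.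
(* For d = 0 there is no smaller bound to refute; the pair ([x0], [x0]) attains distance 0. *)
case: d => [|d] in Pd dmin *.
  by exists x0, x0; split=> //; exists [::].
have /forallPn[x /forallPn[y /existsPn nw]] : ~~ P d.
  by apply/negP => /dmin; rewrite ltnn.
have lbd j : walk e x y j -> d < j.
  move=> /walkP wj; rewrite ltnNge; apply/negP => lejd.
  by have /negP := nw (Ordinal (lejd : j < d.+1)).
have /existsP[k /walkP wk] := Pd x y.
have dk : d.+1 = k by apply/eqP; rewrite eqn_leq lbd //= -ltnS.
by exists x, y; split=> //; rewrite dk.
Qed.

End Walks.

Section CoveringGraph.
Variables (gT : finGroupType) (m : nat) (S : {set gT}).
Local Open Scope group_scope.

Local Notation G := (Gadj m S).

Lemma Gadj_sym : symmetric G.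
Proof. by case: (Gadj_simple m S). Qed.

Lemma Gadj10 (l : 'I_m.+1) (v u : gT) :
  l != ord0 -> G (l, v) (ord0, u) = (v^-1 * u \in S).
Proof.
move=> l0; rewrite /Gadj /joined !inE /= (negPf l0) /= orbF.
apply/existsP/idP => [[t /andP[tS /eqP->]]|uS]; first by rewrite mulKg.
by exists (v^-1 * u); rewrite uS mulKVg eqxx.
Qed.

Lemma Gadj_side (x y : vertex gT m) : G x y -> (x.1 == ord0) = (y.1 != ord0).
Proof.
by case/orP=> /and3P[]; rewrite !inE => /negPf-> ->.
Qed.

(** The neighbours of (0, u) are the (l, u t^-1) with l nonzero and t in S: the product of m labels
    with an injective image of S. *)
Lemma degree_V0 (x : vertex gT m) : x \in V0 gT m -> degree G x = (m * #|S|)%N.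
Proof.
case: x => l u; rewrite inE /= => /eqP->.
transitivity (#|[set~ ord0 : 'I_m.+1]| * #|S|)%N; last by rewrite cardsC1 card_ord.
rewrite /degree -(card_imset S (inj_comp (mulgI u) invg_inj)) -cardsX.
apply: eq_card => -[l' v]; rewrite [in LHS]inE !inE /=.
have [->|l0] := eqVneq l' ord0.
  by apply/negbTE/negP => /Gadj_side; rewrite /= eqxx.
rewrite Gadj_sym Gadj10 //=; apply/idP/imsetP => [vuS|[t tS ->]] /=.
  by exists (v^-1 * u); rewrite //= invMg invgK mulKVg.
by rewrite invMg invgK mulgKV.
Qed.

(** The neighbourhood of (l, v) is {0} x vS. *)
Lemma degree_V1 (x : vertex gT m) : x \in V1 gT m -> degree G x = #|S|.
Proof.
case: x => l v; rewrite inE /= => l0.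
rewrite /degree -[RHS]mul1n -[1%N](cards1 (ord0 : 'I_m.+1)).
rewrite -(card_imset S (mulgI v)) -cardsX.
apply: eq_card => -[l' u]; rewrite [in LHS]inE !inE /=.
have [->|l'0] := eqVneq l' ord0; last first.
  by apply/negbTE/negP => /Gadj_side /=; rewrite l'0 (negPf l0).
rewrite Gadj10 //=; apply/idP/imsetP => [vuS|[t tS ->]].
  by exists (v^-1 * u); rewrite ?mulKVg.
by rewrite mulKg.
Qed.

Hypotheses (abelG : abelian [set: gT]) (covS : covering_set S) (m_gt0 : (0 < m)%N).

Lemma walk_V0_V0 (u u' : gT) : walk G (ord0, u) (ord0, u') 2.
Proof.
have ml0 : (ord_max : 'I_m.+1) != ord0 by rewrite -val_eqE /= -lt0n.
have [t [t' [tS t'S utt']]] := covS (u^-1 * u').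
(* The element t' leads from this midpoint to u, and t leads to u t'^-1 t = u t t'^-1 = u'. The
   label m lies in V_1 because m > 0. *)
apply/walk2P; exists (ord_max, u * t'^-1).
  by rewrite Gadj_sym Gadj10 // invMg invgK mulgKV.
rewrite Gadj10 // invMg invgK -mulgA utt'.
by rewrite (centsP abelG t (in_setT _) t'^-1 (in_setT _)) mulKVg.
Qed.

Lemma walk_V1_V1 (l l' : 'I_m.+1) (v v' : gT) :
  l != ord0 -> l' != ord0 -> walk G (l, v) (l', v') 2.
Proof.
move=> l0 l'0; have [t [t' [tS t'S vtt']]] := covS (v^-1 * v').
(* Since v^-1 v' = t t'^-1, the midpoint v t equals v' t'. *)
apply/walk2P; exists (ord0, v * t); first by rewrite Gadj10 // mulKg.
rewrite Gadj_sym Gadj10 //.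
have -> : v' = v * (t * t'^-1) by rewrite -vtt' mulKVg.
by rewrite !invMg invgK -!mulgA mulKg mulVg mulg1.
Qed.

Lemma walk_V1_V0 (l : 'I_m.+1) (v u : gT) :
  l != ord0 -> walk G (l, v) (ord0, u) 3.
Proof.
(* Covering the identity provides an element of S, hence a first edge into V_0. *)
move=> l0; have [t [_ [tS _ _]]] := covS 1.
by apply: walk_cons (walk_V0_V0 (v * t) u); rewrite Gadj10 // mulKg.
Qed.

Lemma walk_V0_V1 (l : 'I_m.+1) (u v : gT) :
  l != ord0 -> walk G (ord0, u) (l, v) 3.
Proof.
move=> l0; have [t [_ [tS _ _]]] := covS 1.
by apply: walk_rcons (walk_V0_V0 u (v * t)) _; rewrite Gadj_sym Gadj10 // mulKg.
Qed.

Lemma walk_le3 (x y : vertex gT m) : exists2 k, walk G x y k & (k <= 3)%N.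
Proof.
case: x y => l u [l' v].
have [->|l0] := eqVneq l ord0; have [->|l'0] := eqVneq l' ord0.
- by exists 2; first exact: walk_V0_V0.
- by exists 3; first exact: walk_V0_V1.
- by exists 3; first exact: walk_V1_V0.
by exists 2; first exact: walk_V1_V1.
Qed.

(** When S is the whole group the graph is complete bipartite, of diameter at most 2, so the value 3
    requires S to be proper. *)
Lemma diameter3 : S != [set: gT] -> is_diameter G 3.
Proof.
rewrite -subTset => /subsetPn[g _ gS]; split=> [x y|].
  have [k wk lek] := walk_le3 x y; have [d dd led] := walk_distance wk.
  by exists d => //; apply: leq_trans led lek.
have ml0 : (ord_max : 'I_m.+1) != ord0 by rewrite -val_eqE /= -lt0n.
exists (ord_max, 1), (ord0, g); split; first exact: walk_V1_V0.
(* Length 0 would force m = 0, length 1 would put g in S, and length 2 returns to the starting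
   side. *)
case=> [/walk0[/eqP]|[/walk1|[/walk2P[z /Gadj_side xz /Gadj_side zy]|//]]].
- by rewrite eqn0Ngt m_gt0.
- by rewrite Gadj10 // invg1 mul1g (negPf gS).
by move: xz; rewrite zy /= (negPf ml0).
Qed.

End CoveringGraph.

Theorem proposition2p2 (gT : finGroupType) (n s m : nat) (S : {set gT})
    (abelG : abelian [set: gT]) (cardG : #|gT| = n)
    (covS : covering_set S) (cardS : #|S| = s) (m_ge1 : 1 <= m) :
  [/\ #|V0 gT m :|: V1 gT m| = (m + 1) * n,
      forall x, x \in V0 gT m -> degree (Gadj m S) x = m * s,
      forall x, x \in V1 gT m -> degree (Gadj m S) x = s,
      (exists2 d : nat, is_diameter (Gadj m S) d & d <= 3)
    & S != [set: gT] -> is_diameter (Gadj m S) 3].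
Proof.
split.
- have [-> _ _ _] := Gadj_bipartite m S.
  by rewrite cardsT card_prod card_ord cardG addn1.
- by move=> x; rewrite -cardS; apply: degree_V0.
- by move=> x; rewrite -cardS; apply: degree_V1.
- by apply: (diameter_le (ord0, 1%g)); apply: walk_le3.
exact: diameter3.
Qed.
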